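(* Let $r,s\ge 1$ and $b\ge 0$ be integers. Let $a_0:=\sum_{i=0}^{r-1}\binom{s}{i}$ and $a_1:=2^s-a_0$. Then for every $n$, $$\psi^s_{r,b}(n)\le\sum_{i=0}^b\binom{n}{i}a_0^{\,n-i}a_1^{\,i}.$$
   Context: A set system $(X,\mathcal{F})$ consists of a set $X$ and a collection $\mathcal{F}\subseteq\mathcal{P}(X)$. Write $[j]=\{0,\dots,j-1\}$; sequences are indexed from $0$. Here $2^s$ also denotes the set of binary sequences of length $s$; $(2^s)^{<n}$ is the set of sequences of length less than $n$ of elements of $2^s$, and $(2^s)^n$ those of length $n$. A $2^s$-ary element tree of height $n$ with labels from $X$ is a labeling of each node $\nu\in(2^s)^{<n}$ by an $s$-tuple $x_\nu=(x_{\nu,0},\dots,x_{\nu,s-1})$ of elements of $X$. A leaf is an element $\xi\in(2^s)^n$. A leaf $\xi$ is properly labeled by a set $A$ if for all $j<n$ and all $i<s$, $x_{\xi|_{[j]},i}\in A$ iff $\xi(j)(i)=1$. For $r\ge1$, the $\mathrm{op}_r$-rank $\mathrm{opR}_r(\mathcal{F})$ is the largest $k<\omega$ such that there is a $2^r$-ary element tree of height $k$ with labels from $X$ such that every leaf is properly labeled by some element of $\mathcal{F}$; it is infinite if there are such trees of arbitrary height, and $-\infty$ if $\mathcal{F}=\emptyset$. $\psi^s_{r,b}(n)$ denotes the greatest possible number of leaves properly labeled by elements of $\mathcal{F}$ in a $2^s$-ary element tree of height $n$, over all set systems $(X,\mathcal{F})$ with $\mathrm{opR}_r(\mathcal{F})\le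 b<\omega$ and all such trees with labels from $X$. *)

(* Defs.v *)
From mathcomp Require Import all_boot all_order all_algebra.
From mathcomp Require Import boolp classical_sets constructive_ereal.

Set Implicit Arguments.
Unset Strict Implicit.
Unset Printing Implicit Defensive.

Local Open Scope classical_set_scope.

(* Only meaningful when [A] has a greatest element (see [greatestP]); the value
   is 0 otherwise. *)
Definition greatest (A : set nat) : nat :=
  xget 0 [set k | A k /\ forall m, A m -> m <= k].

Lemma greatestP (A : set nat) (N : nat) :
  A !=set0 -> (forall m, A m -> m <= N) ->
  A (greatest A) /\ forall m, A m -> m <= greatest A.
Proof.
move=> [k0 Ak0] AN.
have ex : exists k, `[< A k >] by exists k0; apply/asboolP.
have ub k : `[< A k >] -> k <= N by move/asboolP/AN.
have [k /asboolP Ak kmax] := ex_maxnP ex ub.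
rewrite /greatest; case: xgetP => [y -> []//|no]; exfalso.
by apply: (no k); split=> // m Am; apply/kmax/asboolP.
Qed.

Definition node (s n : nat) : Type :=
  {nu : seq (s.-tuple bool) | size nu < n}.

Definition leaf (s n : nat) : finType := n.-tuple (s.-tuple bool).

(* Labels are only given on the nodes of length < n, so that a tree of height 0
   exists even when [X] is empty. *)
Definition element_tree (X : Type) (s n : nat) : Type := node s n -> s.-tuple X.

Lemma size_restr (s n : nat) (xi : leaf s n) (j : 'I_n) : size (take j xi) < n.
Proof. by rewrite size_takel ?size_tuple // ltnW. Qed.

Definition restr (s n : nat) (xi : leaf s n) (j : 'I_n) : node s n :=
  exist _ (take j xi) (size_restr xi j).

Definition properly_labeled (X : Type) (s n : nat) (x : element_tree X s n)
    (xi : leaf s n) (A : set X) : Prop :=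
  forall (j : 'I_n) (i : 'I_s),
    A (tnth (x (restr xi j)) i) <-> tnth (tnth xi j) i = true.

Definition has_full_tree (X : Type) (F : set (set X)) (r k : nat) : Prop :=
  exists x : element_tree X r k,
    forall xi : leaf r k, exists2 A, F A & properly_labeled x xi A.

Definition opR (r : nat) (X : Type) (F : set (set X)) : \bar int :=
  if `[< F = set0 >] then -oo%E
  else if `[< forall N, exists2 k, N <= k & has_full_tree F r k >] then +oo%E
  else (Posz (greatest [set k | has_full_tree F r k]))%:E%E.

Lemma opR_greatest (r : nat) (X : Type) (F : set (set X)) :
  F <> set0 -> ~ (forall N, exists2 k, N <= k & has_full_tree F r k) ->
  has_full_tree F r (greatest [set k | has_full_tree F r k]) /\
  forall k, has_full_tree F r k ->
    k <= greatest [set k | has_full_tree F r k].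
Proof.
move=> /eqP/set0P[A FA] /existsNP[N noN].
apply: (@greatestP [set k | has_full_tree F r k] N).
  have x : element_tree X r 0 by case.
  by exists 0, x => xi; exists A => // -[].
move=> k Fk; rewrite leqNgt; apply/negP => /ltnW Nk.
by apply: noN; exists k.
Qed.

Definition nb_labeled (X : Type) (F : set (set X)) (s n : nat)
    (x : element_tree X s n) : nat :=
  #|[set xi : leaf s n | `[< exists2 A, F A & properly_labeled x xi A >]]%SET|.

Definition attainable (s r b n : nat) : set nat :=
  [set m | exists (X : Type) (F : set (set X)) (x : element_tree X s n),
     (opR r F <= (Posz b)%:E)%E /\ m = nb_labeled F x].

Definition psi (s r b n : nat) : nat := greatest (attainable s r b n).

Lemma psi_greatest (s r b n : nat) :
  attainable s r b n (psi s r b n) /\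
  forall m, attainable s r b n m -> m <= psi s r b n.
Proof.
apply: (@greatestP _ #|{: leaf s n}|); last first.
  by move=> _ [X [F [x [_ ->]]]]; exact: max_card.
pose x : element_tree unit s n := fun=> [tuple tt | i < s].
exists (nb_labeled set0 x), unit, set0, x; split=> //.
by rewrite /opR; case: asboolP => // _; rewrite leNye.
Qed.

(* Main.v *)
Require Import Defs.
From mathcomp Require Import all_boot all_order all_algebra.
From mathcomp Require Import boolp classical_sets constructive_ereal.

(** Cut a tree of height [n.+1] at its root.  A leaf properly labeled by an
    element of [F] consists of its first entry [v : 2^s] and of a leaf of the
    subtree above [v], properly labeled by a member of [section F l v], the sets
    [A] in [F] whose trace on the root label [l] is exactly [v].  So the number of
    labeled leaves is the sum over [v] of the same numbers for the subtrees
    ([nb_labeledS]).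

    Suppose that [F] admits no full [2^r]-ary tree of height [c.+1].  Call [v]
    heavy if [section F l v] has a full tree of height [c].  Were there more than
    [a0] heavy vectors, the Sauer-Shelah lemma ([sauer_shelah]) would give [r]
    coordinates on which they realise all [2^r] patterns; the root labels at
    these coordinates, with the full trees of suitable heavy sections above them,
    would form a full tree of height [c.+1] for [F] ([full_tree_shattered]).
    Hence at most [a0] sections are heavy, and these inherit from [F] the absence
    of full trees of height [c.+1], whereas the remaining ones have no full tree
    of height [c].  The bound [leaf_bound n c], the sum of the theorem with
    [c = b.+1], satisfies the matching Pascal recursion
    [leaf_bound n.+1 c.+1 = a0 * leaf_bound n c.+1 + a1 * leaf_bound n c], and an
    induction on [n] concludes ([nb_labeled_le]).

    Counting with the least forbidden height [c] instead of the rank [b] makes the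
    empty family the case [c = 0], so that rank [-oo] needs no separate
    treatment. *)

Set Implicit Arguments.
Unset Strict Implicit.
Unset Printing Implicit Defensive.

(** * The Sauer-Shelah lemma for binary tuples *)

Lemma big_tuple_cons (T : finType) n (f : n.+1.-tuple T -> nat) :
  \sum_(t : n.+1.-tuple T) f t =
  \sum_(v : T) \sum_(t : n.-tuple T) f (cons_tuple v t).
Proof.
rewrite pair_bigA /=.
rewrite (reindex (fun p : T * n.-tuple T => cons_tuple p.1 p.2)) //=.
exists (fun t : n.+1.-tuple T => (thead t, behead_tuple t)) => [[v t] _|t _] /=.
  by congr pair; apply: val_inj.
by rewrite [RHS]tuple_eta; apply: val_inj.
Qed.

Lemma card_sum_mem (T : finType) (A : {set T}) : #|A| = \sum_(x : T) (x \in A).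
Proof. by rewrite -sum1_card big_mkcond; apply: eq_bigr => x _; case: ifP. Qed.

Lemma sum_binS s r :
  \sum_(0 <= i < r.+1) 'C(s.+1, i) =
  \sum_(0 <= i < r.+1) 'C(s, i) + \sum_(0 <= i < r) 'C(s, i).
Proof.
rewrite big_nat_recl // [in RHS]big_nat_recl // !bin0 -addnA -big_split /=.
by congr (_ + _); apply: eq_bigr => i _; rewrite binS.
Qed.

Definition shatters s r (V : {set s.-tuple bool}) (f : 'I_r -> 'I_s) : Prop :=
  forall p : r.-tuple bool,
    exists2 v, v \in V & forall i, tnth v (f i) = tnth p i.

(** Induction on [s].  Splitting [V] by the first bit into [V0] and [V1], one has
    [#|V| = #|V0 :|: V1| + #|V0 :&: V1|], which by Pascal's rule matches the two
    halves of the bound.  If the union is large it already shatters [r]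
    coordinates; if the intersection is large it shatters [r.-1] of them, and the
    first coordinate can be added since it takes both values freely. *)
Lemma sauer_shelah s r (V : {set s.-tuple bool}) :
  \sum_(0 <= i < r) 'C(s, i) < #|V| -> exists f : 'I_r -> 'I_s, shatters V f.
Proof.
elim: s r V => [|s IH] [|r] V.
- rewrite big_geq // => /card_gt0P [v vV].
  by exists (fun i => i) => p; exists v => // -[].
- rewrite big_nat_recl // bin0 => lt1; exfalso.
  have := leq_trans lt1 (max_card V).
  by rewrite card_tuple expn0.
- rewrite big_geq // => /card_gt0P [v vV].
  by exists (fun=> ord0) => p; exists v => // -[].
pose V_ b := [set t : s.-tuple bool | cons_tuple b t \in V]%SET.
have -> : #|V| = #|V_ true| + #|V_ false|.
  rewrite !card_sum_mem big_tuple_cons big_bool /=.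
  by congr (_ + _); apply: eq_bigr => t _; rewrite inE.
rewrite sum_binS -cardsUI => large.
have [/IH[f Vf]|smallU] :=
  ltnP (\sum_(0 <= i < r.+1) 'C(s, i)) #|V_ true :|: V_ false|%SET.
  exists (fun i => lift ord0 (f i)) => p.
  have [v vU vp] := Vf p.
  have [b vb] : exists b, cons_tuple b v \in V.
    by move: vU; rewrite !inE => /orP[]; [exists true | exists false].
  by exists (cons_tuple b v) => // i; rewrite tnthS.
have /IH[f Vf] : \sum_(0 <= i < r) 'C(s, i) < #|V_ true :&: V_ false|%SET.
  rewrite ltnNge; apply/negP => smallI.
  by move: large; rewrite ltnNge leq_add.
exists (fun i => if unlift ord0 i is Some j then lift ord0 (f j) else ord0) => p.
have [v vI vp] := Vf (behead_tuple p).
exists (cons_tuple (thead p) v).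
  by move: vI; rewrite !inE => /andP[]; case: (thead p).
move=> i; case: unliftP => [j|] ->; last by rewrite tnth0.
by rewrite tnthS vp [in RHS](tuple_eta p) tnthS.
Qed.

(** * Cutting trees at the root *)

Definition node_root s n : node s n.+1 := exist _ [::] isT.

Definition node_cons s n (v : s.-tuple bool) (nu : node s n) : node s n.+1 :=
  let: exist w hw := nu in exist _ (v :: w) hw.

Definition subtree X s n (x : element_tree X s n.+1) (v : s.-tuple bool) :
    element_tree X s n :=
  fun nu => x (node_cons v nu).

Definition graft X s n (l : s.-tuple X)
    (y : s.-tuple bool -> element_tree X s n) : element_tree X s n.+1 :=
  fun nu => let: exist w hw := nu in
    match w return size w < n.+1 -> s.-tuple X with
    | [::] => fun=> l
    | v :: w' => fun h => y v (exist _ w' h)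
    end hw.

Lemma subtree_graft X s n (l : s.-tuple X)
    (y : s.-tuple bool -> element_tree X s n) v :
  subtree (graft l y) v = y v.
Proof. by apply: funext => -[]. Qed.

Definition trace_is X s (l : s.-tuple X) (v : s.-tuple bool) (A : set X) : Prop :=
  forall i, A (tnth l i) <-> tnth v i = true.

Definition section X s (F : set (set X)) (l : s.-tuple X) (v : s.-tuple bool) :
    set (set X) :=
  fun A => F A /\ trace_is l v A.

Lemma properly_labeled_cons X s n (x : element_tree X s n.+1) v (xi : leaf s n)
    (A : set X) :
  properly_labeled x (cons_tuple v xi : leaf s n.+1) A <->
  trace_is (x (node_root s n)) v A /\ properly_labeled (subtree x v) xi A.
Proof.
have restr0 : restr (cons_tuple v xi : leaf s n.+1) ord0 = node_root s n.
  exact: val_inj.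
have restrS j : restr (cons_tuple v xi : leaf s n.+1) (lift ord0 j) =
    node_cons v (restr xi j).
  exact: val_inj.
split=> [xA|[rA xA] j i].
  by split=> [i|j i]; [have := xA ord0 i | have := xA (lift ord0 j) i];
    rewrite ?restr0 ?restrS ?tnth0 ?tnthS.
have [k ->|->] := unliftP ord0 j; last by rewrite restr0 tnth0; exact: rA.
by rewrite restrS tnthS; exact: xA.
Qed.

Lemma nb_labeledS X (F : set (set X)) s n (x : element_tree X s n.+1) :
  nb_labeled F x =
  \sum_(v : s.-tuple bool)
    nb_labeled (section F (x (node_root s n)) v) (subtree x v).
Proof.
rewrite /nb_labeled card_sum_mem big_tuple_cons; apply: eq_bigr => v _.
rewrite card_sum_mem; apply: eq_bigr => xi _; rewrite !inE; congr nat_of_bool.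
apply: asbool_equiv_eq; split=> [[A FA /properly_labeled_cons[lA xA]]|].
  by exists A.
by case=> A [FA lA] xA; exists A => //; apply/properly_labeled_cons.
Qed.

(** * Full trees *)

Lemma has_full_tree0 X (F : set (set X)) r : F !=set0%classic -> has_full_tree F r 0.
Proof.
move=> [A FA]; have x : element_tree X r 0 by case.
by exists x => xi; exists A => // -[].
Qed.

Lemma has_full_tree_sub X (F G : set (set X)) r k :
  (F `<=` G)%classic -> has_full_tree F r k -> has_full_tree G r k.
Proof.
by move=> FG [x Fx]; exists x => xi; have [A /FG GA xA] := Fx xi; exists A.
Qed.

(** The grafting step: the labels of the shattered coordinates become the root of
    a taller full tree. *)
Lemma full_tree_shattered X (F : set (set X)) s (l : s.-tuple X) r k
    (V : {set s.-tuple bool}) (f : 'I_r -> 'I_s) :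
  (forall v, v \in V -> has_full_tree (section F l v) r k) ->
  shatters V f -> has_full_tree F r k.+1.
Proof.
move=> fullV Vf.
have /choice[y yP] (p : r.-tuple bool) : exists y : element_tree X r k,
    forall xi : leaf r k, exists2 A, section F [tuple tnth l (f i) | i < r] p A
      & properly_labeled y xi A.
  have [v /fullV[y Fy] vp] := Vf p.
  exists y => xi; have [A [FA lA] yA] := Fy xi.
  by exists A => //; split=> // i; rewrite tnth_mktuple -vp.
exists (graft [tuple tnth l (f i) | i < r] y) => xi.
have -> : xi = cons_tuple (thead xi) (behead_tuple xi).
  by rewrite [LHS]tuple_eta; apply: val_inj.
have [A [FA lA] yA] := yP (thead xi) (behead_tuple xi).
by exists A => //; apply/properly_labeled_cons; rewrite subtree_graft.
Qed.

(** If [F] is empty its rank is [-oo], and there is no full tree because the tree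
    has at least one leaf, which no set labels. *)
Lemma opR_le_no_full_tree X (F : set (set X)) r b :
  (opR r F <= (Posz b)%:E)%E -> ~ has_full_tree F r b.+1.
Proof.
rewrite /opR; case: asboolP => [-> _ [x Fx]|F0].
  by have [A []] := Fx [tuple of nseq b.+1 [tuple of nseq r false]].
case: asboolP => // bounded; rewrite lee_fin lez_nat => le_b full.
have [_ /(_ _ full) lt_b] := opR_greatest F0 bounded.
by have := leq_trans lt_b le_b; rewrite ltnn.
Qed.

(** * The bound *)

Section LeafBound.

Variables (a0 a1 : nat).

Definition leaf_bound n c := \sum_(0 <= i < c) 'C(n, i) * a0 ^ (n - i) * a1 ^ i.

Lemma leaf_boundS n c :
  leaf_bound n.+1 c.+1 = a0 * leaf_bound n c.+1 + a1 * leaf_bound n c.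
Proof.
have absorb i : 'C(n, i) * a0 ^ (n.+1 - i) = a0 * ('C(n, i) * a0 ^ (n - i)).
  have [le_in|lt_ni] := leqP i n; last by rewrite bin_small // !mul0n muln0.
  by rewrite subSn // expnS mulnCA.
rewrite /leaf_bound !big_distrr /= big_nat_recl // [in RHS]big_nat_recl //.
rewrite -addnA -big_split /=; congr (_ + _).
  by rewrite !bin0 !subn0 !expn0 !mul1n !muln1 expnS.
apply: eq_bigr => i _.
rewrite binS !mulnDl absorb -!mulnA; congr (_ + _).
by rewrite subSS expnS (mulnCA _ a1) (mulnCA _ a1).
Qed.

Lemma leaf_bound_leS n c : leaf_bound n c <= leaf_bound n c.+1.
Proof. by rewrite /leaf_bound big_nat_recr //= leq_addr. Qed.

End LeafBound.

Lemma sum_bin_le s r : \sum_(0 <= i < r) 'C(s, i) <= 2 ^ s.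
Proof.
elim: s r => [|s IH] [|r]; [by rewrite big_geq | | by rewrite big_geq |].
  by rewrite big_nat_recl // big1_seq // => i; rewrite bin0n.
by rewrite sum_binS expnS mul2n -addnn leq_add.
Qed.

(** Raising [#|V|] to [a] replaces [a - #|V|] summands [N1] of the bound by the larger
    [N0]. *)
Lemma leq_sum_card (T : finType) (V : {set T}) (g : T -> nat) a N0 N1 :
  #|V| <= a -> a <= #|T| -> N1 <= N0 ->
  (forall v, v \in V -> g v <= N0) -> (forall v, v \notin V -> g v <= N1) ->
  \sum_v g v <= a * N0 + (#|T| - a) * N1.
Proof.
move=> Va aT N10 gV gC.
rewrite (bigID (mem V)) /=.
have le0 : \sum_(v in V) g v <= #|V| * N0.
  by rewrite -sum_nat_const; apply: leq_sum.
have le1 : \sum_(v | v \notin V) g v <= (#|T| - #|V|) * N1.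
  have -> : #|T| - #|V| = #|[predC V]| by rewrite -(cardC V) addKn.
  by rewrite -sum_nat_const; apply: leq_sum.
apply: leq_trans (leq_add le0 le1) _.
rewrite -(subnKC Va) mulnDl -addnA leq_add2l.
have -> : #|T| - #|V| = (a - #|V|) + (#|T| - a).
  by rewrite addnC addnBA // subnK.
by rewrite mulnDl subnKC // leq_add2r leq_mul2l N10 orbT.
Qed.

(** Induction on the height.  It must range over all families and all [c], as it
    is applied to the sections at the root: with the same height [c.+1] for the
    heavy ones, and with [c] for the others. *)
Lemma nb_labeled_le X (F : set (set X)) r s n c (x : element_tree X s n) :
  ~ has_full_tree F r c ->
  nb_labeled F x <=
  leaf_bound (\sum_(0 <= i < r) 'C(s, i)) (2 ^ s - \sum_(0 <= i < r) 'C(s, i)) n c.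
Proof.
move=> noF; set a0 := \sum_(0 <= i < r) _; elim: n X F c x noF => [|n IH] X F [|c] x noF.
(* For [c = 0] the family is empty, since any member gives a tree of height 0. *)
1,3: rewrite /nb_labeled eq_card0 // => xi; rewrite !inE;
  by apply/asboolP => -[A FA _]; apply/noF/has_full_tree0; exists A.
  rewrite /leaf_bound big_nat_recl // bin0 !expn0 !mul1n.
  by apply: leq_trans (leq_addr _ _); rewrite (leq_trans (max_card _)) ?card_tuple.
set l := x (node_root s n).
pose V := [set v | `[< has_full_tree (section F l v) r c >]]%SET.
have cardT : #|{: s.-tuple bool}| = 2 ^ s by rewrite card_tuple card_bool.
rewrite nb_labeledS leaf_boundS -cardT.
apply: (leq_sum_card (V := V)); rewrite ?cardT ?sum_bin_le ?leaf_bound_leS //.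
- rewrite leqNgt; apply/negP => /sauer_shelah[f Vf].
  apply: noF; apply: (full_tree_shattered (l := l) _ Vf) => v.
  by rewrite inE => /asboolP.
- move=> v _; apply: IH => full; apply: noF.
  by apply: has_full_tree_sub full => A [].
- by move=> v; rewrite inE => /asboolP; exact: IH.
Qed.

Theorem theorem5p14 (r s b : nat) (hr : 1 <= r) (hs : 1 <= s) (n : nat) :
  let a0 := \sum_(0 <= i < r) 'C(s, i) in
  let a1 := 2 ^ s - a0 in
  psi s r b n <= \sum_(0 <= i < b.+1) 'C(n, i) * a0 ^ (n - i) * a1 ^ i.
Proof.
cbv zeta.
have [[X [F [x [/opR_le_no_full_tree noF ->]]]] _] := psi_greatest s r b n.
exact: nb_labeled_le noF.
Qed.
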